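(* Let $Q(x)=\sum_{k\geq0}op_{[2^k]}(123)x^{2k}$. Then \begin{align*} &\left(\tfrac{21}{2}x^7+\tfrac{329}{8}x^5-\tfrac{7}{2}x^3\right)Q'''(x)+\left(99x^6+\tfrac{1443}{8}x^4-5x^2\right)Q''(x)\\ &\qquad+\left(207x^5+\tfrac{717}{8}x^3+11x\right)Q'(x)+(72x^4-12x^2)Q(x)=0. \end{align*}
   Context: An ordered partition of $[n]=\{1,\dots,n\}$ is a sequence $B_1/\cdots/B_k$ of nonempty pairwise disjoint subsets of $[n]$ with union $[n]$. It contains the pattern $123$ if there are indices $i_1<i_2<i_3$ and elements $b_j\in B_{i_j}$ with $b_1<b_2<b_3$; otherwise it avoids $123$. $op_{[2^k]}(123)$ is the number of $123$-avoiding ordered partitions of $[2k]$ with $k$ blocks each of size $2$ (with $op_{[2^0]}(123)=1$). *)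

(* Defs.v *)
From mathcomp Require Import all_boot all_order all_algebra.

Set Implicit Arguments.
Unset Strict Implicit.
Unset Printing Implicit Defensive.

Import GRing.Theory.
Local Open Scope ring_scope.

(* The ground set [n] = {1, ..., n} is represented by 'I_n = {0, ..., n - 1}
   with its natural order. *)
Definition ordered_partition (n k : nat) (B : k.-tuple {set 'I_n}) : bool :=
  [&& [forall i : 'I_k, tnth B i != set0],
      [forall i : 'I_k, forall j : 'I_k,
         (i != j) ==> [disjoint tnth B i & tnth B j]]
    & \bigcup_(i < k) tnth B i == [set: 'I_n]].

Definition contains123 (n k : nat) (B : k.-tuple {set 'I_n}) : bool :=
  [exists i1 : 'I_k, exists i2 : 'I_k, exists i3 : 'I_k,
    (i1 < i2 < i3)%N &&
    [exists b1 in tnth B i1, exists b2 in tnth B i2, exists b3 in tnth B i3,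
      (b1 < b2 < b3)%N]].

Definition op2_123 (k : nat) : nat :=
  #|[set B : k.-tuple {set 'I_(2 * k)} |
      [&& ordered_partition B,
          [forall i : 'I_k, #|tnth B i| == 2%N]
        & ~~ contains123 B]]|.

(* A formal power series is its coefficient sequence: s n is the coefficient
   of x^n.  Equality of series is pointwise equality =1. *)
Definition fps (R : nzRingType) : Type := nat -> R.

Section FormalPowerSeries.
Variable R : nzRingType.
Implicit Types s t : fps R.

Definition fps0 : fps R := fun _ => 0.
Definition fps_add s t : fps R := fun n => s n + t n.
Definition fps_mul s t : fps R := fun n => \sum_(i < n.+1) s i * t (n - i)%N.
Definition fps_deriv s : fps R := fun n => s n.+1 *+ n.+1.
Definition fps_poly (p : {poly R}) : fps R := fun n => p`_n.

End FormalPowerSeries.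

Arguments fps0 {R} _.

Declare Scope fps_scope.
Delimit Scope fps_scope with fps.
Bind Scope fps_scope with fps.
Notation "s + t" := (fps_add s t) : fps_scope.
Notation "s * t" := (fps_mul s t) : fps_scope.
Notation "p %:S" := (fps_poly p%R)
  (at level 2, left associativity, format "p %:S") : fps_scope.
Notation "s ^`( m )" := (iter m (@fps_deriv _) s) : fps_scope.

(* Q(x) = \sum_(k >= 0) op2_123 k x^(2k) *)
Definition Q : fps rat :=
  fun n => if odd n then 0 else (op2_123 n./2)%:R.

(* Main.v *)
(** Reading off the block index of each element turns the partitions into words
    in which every letter below [k] occurs twice and which avoid 123.  Such a word
    arises from a unique smaller one by inserting two copies of the new largest
    letter into its maximal weakly decreasing prefix.  If that prefix has length
    [s], the prefix lengths of the new words are [s + 2], [i + 1] for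
    [1 <= i <= s], and [j] for [1 <= j <= i <= s].  With [F(z, u)] counting words
    by number of distinct letters and prefix length, and [u = 1 + v], the kernel of the
    resulting functional equation is [z (1 + v)^2 (1 + v + v^2) = v^2].  It is
    palindromic in [v], and its roots are those of
      [(v^2 - 3 p v - q) (1 - 3 p v - q v^2)],
    where [q = p / (1 + p)] and [z = e / (1 + 3 e)^2] with [e = p (1 + p)].  The
    kernel method gives
      [F(z, 1) = (1 + 3 e) / (1 + 2 p)],
      [F(z, 1 + v) = F(z, 1) (1 - q v) / (1 - 3 p v - q v^2)].
    The coefficients of [v^m] are the binomial moments of the prefix length, and
    the last formula is verified through their recurrence.  As
    [(1 + 2 p)^2 = 1 + 4 e], the logarithmic derivative of [F(z, 1)] is a rational
    function of [e], which makes the differential equation a polynomial identity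
    in [e]. *)

Require Import Defs.
From HB Require Import structures.
From mathcomp Require Import all_boot all_order all_algebra.
From mathcomp Require Import boolp functions.
From mathcomp Require Import ring zify.

Set Implicit Arguments.
Unset Strict Implicit.
Unset Printing Implicit Defensive.

Import GRing.Theory.

(** * Words *)

Section InsertAt.
Variable T : eqType.
Implicit Types (x : T) (s : seq T).

Definition insert_at x s (i : nat) : seq T := take i s ++ x :: drop i s.

Lemma perm_insert_at x s i : perm_eq (insert_at x s i) (x :: s).
Proof. by rewrite -cat1s /insert_at -(cat1s x) perm_catCA cat_take_drop. Qed.

Lemma take_insert_at x s i j :
  j <= i -> i <= size s -> take j (insert_at x s i) = take j s.
Proof. by move=> ji si; rewrite takel_cat ?size_takel // take_takel. Qed.

Lemma index_insert_at x s i :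
  i <= size s -> x \notin take i s -> index x (insert_at x s i) = i.
Proof. by move=> si xs; rewrite index_cat (negPf xs) /= eqxx addn0 size_takel. Qed.

Lemma rem_insert_at x s i : x \notin take i s -> rem x (insert_at x s i) = s.
Proof.
elim: s i => [|y s IH] [|i] //=; rewrite /insert_at /= ?eqxx //.
by rewrite inE negb_or eq_sym => /andP[/negPf-> /IH->].
Qed.

Lemma insert_at_rem x s : x \in s -> insert_at x (rem x s) (index x s) = s.
Proof.
elim: s => //= y s IH; rewrite inE eq_sym; case: eqVneq => [<-|_] /= xs.
  by rewrite /insert_at take0 drop0.
by rewrite -[in RHS](IH xs).
Qed.

Lemma leq_index_rem x s : index x s <= index x (rem x s).
Proof. by elim: s => //= y s IH; case: eqP => //= /eqP/negPf->. Qed.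

(* For [j <= i] the two copies end up at the positions [j] and [i + 1]. *)
Definition insert_twice x s (ij : nat * nat) : seq T :=
  insert_at x (insert_at x s ij.1) ij.2.

Lemma perm_insert_twice x s ij : perm_eq (insert_twice x s ij) [:: x, x & s].
Proof. by rewrite (permPl (perm_insert_at _ _ _)) perm_cons perm_insert_at. Qed.

Definition remove_twice x s : seq T * (nat * nat) :=
  (rem x (rem x s), (index x (rem x s), index x s)).

Lemma insert_twiceK x s i j : x \notin s -> j <= i <= size s ->
  remove_twice x (insert_twice x s (i, j)) = (s, (i, j)).
Proof.
move=> xs /andP[ji si].
have xt n : x \notin take n s by apply: contra xs; apply: mem_take.
have sj : j <= size (insert_at x s i).
  by rewrite (perm_size (perm_insert_at _ _ _)) /= leqW // (leq_trans ji).
by rewrite /remove_twice !(rem_insert_at, index_insert_at, take_insert_at).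
Qed.

Lemma remove_twiceK x s (t := remove_twice x s) : 1 < count_mem x s ->
  insert_twice x t.1 t.2 = s /\ t.2.2 <= t.2.1 <= size t.1.
Proof.
move=> xs; have x1 : x \in s by rewrite -has_pred1 has_count ltnW.
have x2 : x \in rem x s by rewrite -has_pred1 has_count count_rem x1 /= eqxx subn_gt0.
split; first by rewrite /insert_twice /= !insert_at_rem.
rewrite /= leq_index_rem size_rem //; rewrite -index_mem in x2.
by rewrite -ltnS (ltn_predK x2).
Qed.

End InsertAt.

Fixpoint avoids123 (w : seq nat) : bool :=
  if w is x :: w' then
    pairwise (fun a b => ~~ (x < a < b)) w' && avoids123 w'
  else true.

Fixpoint descent_prefix (w : seq nat) : nat :=
  if w is x :: w' then
    if w' is y :: _ then if y <= x then (descent_prefix w').+1 else 1 else 1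
  else 0.

Lemma avoids123P (w : seq nat) :
  reflect (forall x y z, x < y -> y < z -> z < size w ->
             ~~ (nth 0 w x < nth 0 w y < nth 0 w z))
          (avoids123 w).
Proof.
elim: w => [|a w IH] /=; first by apply: ReflectT => x y z _ _; rewrite ltn0.
apply: (iffP andP) => [[/(pairwiseP 0) pw /IH av] [|x] [|y] [|z] //= xy yz zw|no123].
- by apply: pw => //; rewrite inE; lia.
- exact: av.
split.
  by apply/(pairwiseP 0) => i j; rewrite !inE => ii jj ij; apply: (no123 0 i.+1 j.+1).
by apply/IH => x y z xy yz zw; apply: (no123 x.+1 y.+1 z.+1).
Qed.

Lemma avoids123_cat_cons (m : nat) (p r : seq nat) :
  all (gtn m) p -> all (geq m) r ->
  avoids123 (p ++ m :: r) = avoids123 (p ++ r) && sorted geq p.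
Proof.
move=> + rm; elim: p => [_|x p IH] /=.
  rewrite andbT; suff -> : pairwise (fun a b => ~~ (m < a < b)) r by [].
  elim: r rm => [//|y r IHr] /= /andP[ym rm]; rewrite IHr // andbT.
  by apply/allP => z _; lia.
move=> /andP[xm pm]; rewrite IH // (path_sortedE (rev_trans leq_trans)).
rewrite !pairwise_cat allrel_consr /=.
have -> : all (fun a => ~~ (x < a < m)) p = all (geq x) p.
  by apply: eq_in_all => a /(allP pm) /=; lia.
have -> : all (fun b => ~~ (x < m < b)) r.
  by apply/allP => b /(allP rm) /=; lia.
by rewrite /=; case: (all (geq x) p); rewrite ?andbF ?andbT //= -!andbA.
Qed.

Lemma descent_prefix_size (w : seq nat) : descent_prefix w <= size w.
Proof. by elim: w => [//|x [|y w] IH] //=; case: ifP. Qed.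

Lemma sorted_take_descent (w : seq nat) (i : nat) :
  i <= size w -> sorted geq (take i w) = (i <= descent_prefix w).
Proof.
elim: w i => [|x [|y w] IH] [|[|i]] //= iw; first by case: ifP.
by have := IH i.+1 iw; rewrite /= => ->; case: (leqP y x).
Qed.

Lemma descent_prefix_cat_cons (m : nat) (p r : seq nat) :
  0 < size p -> all (gtn m) p -> sorted geq p ->
  descent_prefix (p ++ m :: r) = size p.
Proof.
elim: p => [//|x [|y p] IH] _ /=; first by rewrite andbT ltnNge => /negPf->.
by move=> /andP[xm pm] /andP[yx ps]; rewrite yx; congr _.+1; apply: IH.
Qed.

Lemma avoids123_insert_at (m : nat) (w : seq nat) (i : nat) :
  all (geq m) w -> all (gtn m) (take i w) -> i <= size w ->
  avoids123 (insert_at m w i) = avoids123 w && (i <= descent_prefix w).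
Proof.
move=> wm tm iw; rewrite avoids123_cat_cons ?cat_take_drop ?sorted_take_descent //.
by move: wm; rewrite -{1}(cat_take_drop i w) all_cat => /andP[].
Qed.

Lemma descent_prefix_insert_at (m : nat) (w : seq nat) (i : nat) :
  all (geq m) w -> all (gtn m) (take i w) -> i <= descent_prefix w ->
  descent_prefix (insert_at m w i) = if i is 0 then (descent_prefix w).+1 else i.
Proof.
move=> wm tm iw; have iw' := leq_trans iw (descent_prefix_size w).
case: i iw iw' tm => [_ _ _|i iw iw' tm].
  by rewrite /insert_at take0 drop0; case: w wm => //= y ? /andP[->].
by rewrite descent_prefix_cat_cons ?size_takel // sorted_take_descent.
Qed.

Section InsertLargest.
Variables (m : nat) (w : seq nat) (i j : nat).
Hypothesis w_lt : all (gtn m) w.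
Hypothesis ji : j <= i.

Let w_le : all (geq m) w. Proof. by apply: sub_all w_lt => a; apply: ltnW. Qed.
Let take_lt n : all (gtn m) (take n w).
Proof. by apply/allP => a /mem_take /(allP w_lt). Qed.
Let insert_le : all (geq m) (insert_at m w i).
Proof. by rewrite (perm_all _ (perm_insert_at _ _ _)) /= leqnn. Qed.

Lemma descent_prefix_insert_twice : i <= descent_prefix w ->
  descent_prefix (insert_twice m w (i, j)) =
  if j is 0 then if i is 0 then (descent_prefix w).+2 else i.+1 else j.
Proof.
move=> iw; have iw' := leq_trans iw (descent_prefix_size w).
have dE := descent_prefix_insert_at w_le (take_lt i) iw.
have jd : j <= descent_prefix (insert_at m w i).
  by rewrite dE; case: (i) ji => //; case: (j).
rewrite /insert_twice descent_prefix_insert_at ?take_insert_at //= dE.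
by case: (j); case: (i).
Qed.

Lemma avoids123_insert_twice : i <= size w ->
  avoids123 (insert_twice m w (i, j)) = avoids123 w && (i <= descent_prefix w).
Proof.
move=> iw; have jw : j <= size (insert_at m w i).
  by rewrite (perm_size (perm_insert_at _ _ _)) /= leqW // (leq_trans ji).
rewrite /insert_twice avoids123_insert_at ?take_insert_at //=.
rewrite avoids123_insert_at // -andbA.
congr (_ && _); case: (leqP i (descent_prefix w)) => //= iw'.
rewrite descent_prefix_insert_at //.
by case: (i) ji => //; case: (j).
Qed.

End InsertLargest.

Definition double_word (k : nat) (w : seq nat) : bool :=
  perm_eq w (iota 0 k ++ iota 0 k) && avoids123 w.

Lemma double_wordP (k : nat) (w : seq nat) :
  reflect [/\ size w = 2 * k, all (gtn k) w,
              forall c : 'I_k, count_mem (c : nat) w = 2 & avoids123 w]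
          (double_word k w).
Proof.
have countE c : c < k -> count_mem c (iota 0 k ++ iota 0 k) = 2.
  by move=> ck; rewrite count_cat count_uniq_mem ?iota_uniq // mem_iota ck.
have mem_lt c : c \in iota 0 k ++ iota 0 k -> c < k.
  by rewrite mem_cat mem_iota orbb.
apply: (iffP andP) => [[wk ->]|[sw lt ct ->]]; split=> //.
- by rewrite (perm_size wk) size_cat size_iota mul2n addnn.
- by rewrite (perm_all _ wk); apply/allP => c /mem_lt.
- by move=> c; have /permP -> := wk; apply: countE.
apply/allP => c; rewrite mem_cat /= => /orP[/(allP lt)|/mem_lt] ck;
  by rewrite (ct (Ordinal ck)) countE.
Qed.

Lemma notin_double_word (k : nat) (w : seq nat) : double_word k w -> k \notin w.
Proof.
by case/double_wordP => _ /allP lt _ _; apply/negP => /lt /=; rewrite ltnn.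
Qed.

Lemma double_word_insert_twice (k : nat) (w : seq nat) (i j : nat) :
  j <= i -> i <= size w ->
  double_word k.+1 (insert_twice k w (i, j)) =
  double_word k w && (i <= descent_prefix w).
Proof.
move=> ji iw; rewrite /double_word.
have -> : perm_eq (insert_twice k w (i, j)) (iota 0 k.+1 ++ iota 0 k.+1) =
          perm_eq w (iota 0 k ++ iota 0 k).
  rewrite (permPl (perm_insert_twice _ _ _)).
  have /permPr-> :
      perm_eq (iota 0 k.+1 ++ iota 0 k.+1) [:: k, k & iota 0 k ++ iota 0 k].
    by apply/permP => a; rewrite -addn1 iotaD add0n !count_cat /= !count_cat; lia.
  by rewrite !perm_cons.
have [wk|//] := boolP (perm_eq w _); rewrite avoids123_insert_twice //.
by rewrite (perm_all _ wk); apply/allP => c; rewrite mem_cat mem_iota orbb.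
Qed.

Definition insertion_sites (s : nat) : seq (nat * nat) :=
  [seq (i, j) | i <- iota 0 s.+1, j <- iota 0 i.+1].

Lemma mem_insertion_sites (s i j : nat) :
  ((i, j) \in insertion_sites s) = (j <= i <= s).
Proof.
apply/allpairsPdep/idP => [[i' [j' [+ + [-> ->]]]]|/andP[ji i_le]].
  by rewrite !mem_iota; lia.
by exists i, j; rewrite !mem_iota; split=> //; lia.
Qed.

Lemma insertion_sites_uniq (s : nat) : uniq (insertion_sites s).
Proof.
apply: allpairs_uniq_dep => [|i _|[i j] [i' j'] _ _ [-> ->]] //; exact: iota_uniq.
Qed.

Fixpoint words (k : nat) : seq (seq nat) :=
  if k is k'.+1 then
    [seq insert_twice k' w ij | w <- words k', ij <- insertion_sites (descent_prefix w)]
  else [:: [::]].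

Lemma wordsS (k : nat) :
  words k.+1 =
  [seq insert_twice k w ij | w <- words k, ij <- insertion_sites (descent_prefix w)].
Proof. by []. Qed.

Lemma mem_words (k : nat) (w : seq nat) : (w \in words k) = double_word k w.
Proof.
elim: k w => [|k IH] w; first by rewrite inE; apply/eqP/andP => [->|[/perm_nilP]].
apply/allpairsPdep/idP => [[v [[i j] [+ + ->]]]|wk].
  rewrite IH mem_insertion_sites => vk /andP[ji iv].
  by rewrite double_word_insert_twice ?vk // (leq_trans iv) ?descent_prefix_size.
have [_ _ /(_ ord_max) ct _] := double_wordP _ _ wk.
have [|wE] := @remove_twiceK _ k w; first by rewrite ct.
case: (remove_twice k w) wE => v [i j] /= wE /andP[ji iw].
move: wk; rewrite -wE double_word_insert_twice // => /andP[vk id_le].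
by exists v, (i, j); rewrite mem_insertion_sites ji IH.
Qed.

Lemma words_uniq (k : nat) : uniq (words k).
Proof.
elim: k => [//|k IH]; apply: allpairs_uniq_dep => // [w _|].
  exact: insertion_sites_uniq.
move=> x y /allpairsPdep[v [[i j] [+ + ->]]] /allpairsPdep[v' [[i' j'] [+ + ->]]] /=.
rewrite !mem_words !mem_insertion_sites.
move=> /notin_double_word kv iv /notin_double_word kv' iv'.
have size_le u n l : n <= l <= descent_prefix u -> n <= l <= size u.
  by move=> /andP[-> lu]; rewrite (leq_trans lu) ?descent_prefix_size.
by move/(congr1 (remove_twice k)); rewrite !insert_twiceK ?size_le // => -[-> -> ->].
Qed.

(** * Binomial moments of the prefix length *)

Lemma bin_hockey (n m : nat) : \sum_(i < n) 'C(i, m) = 'C(n, m.+1).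
Proof. by elim: n => [|n IH]; rewrite ?big_ord0 // big_ord_recr /= IH binS. Qed.

Definition children_moment (s m : nat) : nat :=
  'C(s.+2, m) + \sum_(i < s) ('C(i.+2, m) + \sum_(j < i.+1) 'C(j.+1, m)).

Lemma children_moment_binomial (s m : nat) :
  children_moment s m + ((m == 0) * (s + 3) + (m == 1)) =
  'C(s.+2, m) + 'C(s.+2, m.+1) + 'C(s.+2, m.+2).
Proof.
rewrite /children_moment; elim: s => [|s IH].
  by rewrite big_ord0; case: m => [|[|[|m]]].
have inner : \sum_(j < s.+1) 'C(j.+1, m) + (m == 0) = 'C(s.+2, m.+1).
  by rewrite -bin_hockey [RHS]big_ord_recl addnC; case: m {IH}.
rewrite big_ord_recr /= !(binS s.+2) -inner.
case: m IH inner => [|m] /=; rewrite ?bin0 ?(binS s.+2); lia.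
Qed.

Lemma children_moment0 (s : nat) :
  children_moment s 0 = 'C(s, 0) + 2 * 'C(s, 1) + 'C(s, 2).
Proof. by have := children_moment_binomial s 0; rewrite !(binS, bin0, bin1) /=; lia. Qed.

Lemma children_moment1 (s : nat) :
  children_moment s 1 = 2 * 'C(s, 0) + 4 * 'C(s, 1) + 3 * 'C(s, 2) + 'C(s, 3).
Proof. by have := children_moment_binomial s 1; rewrite !(binS, bin0) /=; lia. Qed.

Lemma children_momentSS (s m : nat) :
  children_moment s m.+2 = 'C(s, m) + 3 * 'C(s, m.+1) + 4 * 'C(s, m.+2)
                           + 3 * 'C(s, m.+3) + 'C(s, m.+4).
Proof. by have := children_moment_binomial s m.+2; rewrite !binS /=; lia. Qed.

Definition moment (k m : nat) : nat := \sum_(w <- words k) 'C(descent_prefix w, m).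

Lemma moment_empty (m : nat) : moment 0 m = (m == 0).
Proof. by rewrite /moment big_seq1; case: m. Qed.

Lemma moment0 (k : nat) : moment k 0 = size (words k).
Proof. by rewrite /moment -sum1_size; apply: eq_bigr => w _; apply: bin0. Qed.

Lemma momentS (k m : nat) :
  moment k.+1 m = \sum_(w <- words k) children_moment (descent_prefix w) m.
Proof.
rewrite /moment wordsS big_allpairs_dep /= big_seq [RHS]big_seq.
apply: eq_bigr => w; rewrite mem_words => /double_wordP[_ lt _ _].
have mkord n (F : nat -> nat) : \sum_(i <- iota 0 n) F i = \sum_(i < n) F i.
  by rewrite -[X in iota 0 X]subn0 big_mkord.
rewrite big_allpairs_dep mkord big_ord_recl; congr (_ + _).
  by rewrite big_seq1 descent_prefix_insert_twice.
apply: eq_bigr => i _; rewrite mkord big_ord_recl; congr (_ + _).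
  by rewrite descent_prefix_insert_twice // (ltn_ord i).
apply: eq_bigr => j _; rewrite descent_prefix_insert_twice //= /bump; lia.
Qed.

Lemma moment0S (k : nat) : moment k.+1 0 = moment k 0 + 2 * moment k 1 + moment k 2.
Proof.
rewrite momentS /moment !(big_distrr, =^~ big_split) /=.
by apply: eq_bigr => w _; apply: children_moment0.
Qed.

Lemma moment1S (k : nat) :
  moment k.+1 1 = 2 * moment k 0 + 4 * moment k 1 + 3 * moment k 2 + moment k 3.
Proof.
rewrite momentS /moment !(big_distrr, =^~ big_split) /=.
by apply: eq_bigr => w _; apply: children_moment1.
Qed.

Lemma momentSS (k m : nat) :
  moment k.+1 m.+2 = moment k m + 3 * moment k m.+1 + 4 * moment k m.+2
                     + 3 * moment k m.+3 + moment k m.+4.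
Proof.
rewrite momentS /moment !(big_distrr, =^~ big_split) /=.
by apply: eq_bigr => w _; apply: children_momentSS.
Qed.

(** * Ordered partitions as words *)

Section BlocksOfWord.
Variables n k : nat.
Implicit Types (w : seq nat) (B : k.-tuple {set 'I_n}).

Definition blocks_of_word w : k.-tuple {set 'I_n} :=
  [tuple [set x : 'I_n | nth 0 w x == i] | i < k].

Definition word_of_blocks B : seq nat :=
  [seq find (fun b : {set 'I_n} => x \in b) B | x <- enum 'I_n].

Lemma mem_blocks_of_word w (i : 'I_k) (x : 'I_n) :
  (x \in tnth (blocks_of_word w) i) = (nth 0 w x == i).
Proof. by rewrite tnth_mktuple inE. Qed.

Lemma blocks_of_word_inj w w' :
  size w = n -> size w' = n -> all (gtn k) w ->
  blocks_of_word w = blocks_of_word w' -> w = w'.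
Proof.
move=> sw sw' lt E; apply: (@eq_from_nth _ 0) => [|i iw]; first by rewrite sw.
have ik : nth 0 w i < k by apply: (allP lt); rewrite mem_nth.
rewrite sw in iw; have := mem_blocks_of_word w (Ordinal ik) (Ordinal iw).
by rewrite E mem_blocks_of_word eqxx => /eqP.
Qed.

Lemma card_blocks_of_word w (i : 'I_k) :
  size w = n -> #|tnth (blocks_of_word w) i| = count_mem (i : nat) w.
Proof.
move=> sw; rewrite tnth_mktuple cardsE -sum1_card -sum1_count.
by rewrite (big_nth 0) big_mkord sw.
Qed.

Lemma blocks_of_word_partition w :
  size w = n -> all (gtn k) w -> (forall i : 'I_k, (i : nat) \in w) ->
  ordered_partition (blocks_of_word w).
Proof.
move=> sw lt onto; apply/and3P; split.
- by apply/forallP => i; rewrite -card_gt0 card_blocks_of_word // -has_count has_pred1.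
- apply/forallP => i; apply/forallP => j; apply/implyP => ij.
  rewrite disjoint_subset; apply/subsetP => x.
  rewrite inE !mem_blocks_of_word => /eqP ->.
  by apply: contra ij => /eqP ij; apply/eqP/val_inj.
- apply/eqP/setP => x; rewrite inE; apply/bigcupP.
  have xk : nth 0 w x < k by apply: (allP lt); rewrite mem_nth // sw.
  by exists (Ordinal xk) => //; rewrite mem_blocks_of_word.
Qed.

Lemma contains123_blocks_of_word w :
  size w = n -> all (gtn k) w -> contains123 (blocks_of_word w) = ~~ avoids123 w.
Proof.
move=> sw lt; apply/idP/idP.
  move=> /existsP[i1 /existsP[i2 /existsP[i3 /andP[i123]]]].
  move=> /existsP[b1 /andP[B1 /existsP[b2 /andP[B2 /existsP[b3 /andP[B3 b123]]]]]].
  move: B1 B2 B3; rewrite !mem_blocks_of_word => /eqP B1 /eqP B2 /eqP B3.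
  apply/avoids123P => /(_ b1 b2 b3); rewrite B1 B2 B3 i123 sw ltn_ord.
  by case/andP: b123 => -> -> /(_ isT isT isT).
apply: contraR => nc; apply/avoids123P => x y z xy yz zw.
apply: contra nc => wxyz; rewrite sw in zw.
have yw := ltn_trans yz zw; have xw := ltn_trans xy yw.
have wk i : i < n -> nth 0 w i < k.
  by rewrite -sw => iw; apply: (allP lt); rewrite mem_nth.
apply/existsP; exists (Ordinal (wk _ xw)); apply/existsP; exists (Ordinal (wk _ yw)).
apply/existsP; exists (Ordinal (wk _ zw)); rewrite wxyz /=.
apply/existsP; exists (Ordinal xw); rewrite mem_blocks_of_word eqxx /=.
apply/existsP; exists (Ordinal yw); rewrite mem_blocks_of_word eqxx /=.
by apply/existsP; exists (Ordinal zw); rewrite mem_blocks_of_word eqxx /= xy yz.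
Qed.

Lemma size_word_of_blocks B : size (word_of_blocks B) = n.
Proof. by rewrite size_map size_enum_ord. Qed.

Lemma ordered_partition_has B (x : 'I_n) :
  ordered_partition B -> has (fun b : {set 'I_n} => x \in b) B.
Proof.
case/and3P => _ _ /eqP cover; have := in_setT x; rewrite -cover => /bigcupP[i _ xi].
by apply/hasP; exists (tnth B i) => //; apply: mem_tnth.
Qed.

Lemma word_of_blocks_lt B : ordered_partition B -> all (gtn k) (word_of_blocks B).
Proof.
move=> oB; apply/allP => _ /mapP[x _ ->] /=.
by rewrite -[X in _ < X](size_tuple B) -has_find ordered_partition_has.
Qed.

Lemma word_of_blocksK B : ordered_partition B -> blocks_of_word (word_of_blocks B) = B.
Proof.
move=> oB; have [_ /forallP disj _] := and3P oB.
apply: eq_from_tnth => i; apply/setP => x; rewrite mem_blocks_of_word.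
rewrite (nth_map x) ?size_enum_ord // nth_ord_enum.
have hasB := ordered_partition_has x oB.
have jk := hasB; rewrite has_find size_tuple in jk.
have xj : x \in tnth B (Ordinal jk) by rewrite (tnth_nth set0) (nth_find set0 hasB).
apply/eqP/idP => [ji|xi]; first by rewrite (_ : i = Ordinal jk) //; apply/val_inj.
apply/eqP; apply: contraT => ji; have /forallP/(_ i)/implyP/(_ ji) := disj (Ordinal jk).
by rewrite disjoint_subset => /subsetP/(_ x xj); rewrite inE xi.
Qed.

End BlocksOfWord.

Lemma op2_123_words (k : nat) : op2_123 k = size (words k).
Proof.
pose blocks := @blocks_of_word (2 * k) k.
have inj : {in words k &, injective blocks}.
  move=> w w'; rewrite !mem_words => /double_wordP[sw lt _ _] /double_wordP[sw' _ _ _].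
  exact: blocks_of_word_inj.
have /card_uniqP : uniq [seq blocks w | w <- words k].
  by rewrite map_inj_in_uniq ?words_uniq.
rewrite size_map => <-; apply: eq_card => B; rewrite inE; apply/and3P/mapP.
- move=> [oB /forallP cB avB]; have BE := word_of_blocksK oB.
  have [sw lt] := (size_word_of_blocks B, word_of_blocks_lt oB).
  exists (word_of_blocks B) => //; rewrite mem_words; apply/double_wordP; split=> // [c|].
    by rewrite -(card_blocks_of_word _ sw) BE; apply/eqP.
  by move: avB; rewrite -{1}BE contains123_blocks_of_word // negbK.
- move=> [w + ->]; rewrite mem_words => /double_wordP[sw lt ct av].
  rewrite contains123_blocks_of_word // negbK av blocks_of_word_partition //.
    by split=> //; apply/forallP => i; rewrite card_blocks_of_word // ct.
  by move=> i; rewrite -has_pred1 has_count ct.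
Qed.

(** * The ring of formal power series *)

Local Open Scope ring_scope.

HB.instance Definition _ (R : nzRingType) := GRing.Zmodule.copy (fps R) (nat -> R).

Section FpsRing.
Variable R : comNzRingType.
Implicit Types s t u : fps R.

Definition fps1 : fps R := fun n => (n == 0%N)%:R.

Lemma fps_mul_truncr (N n : nat) s (p : {poly R}) t : (n < N)%N ->
  (forall i, (i < N)%N -> t i = p`_i) ->
  fps_mul s t n = (\poly_(i < N) s i * p)`_n.
Proof.
move=> nN tp; rewrite coefM; apply: eq_bigr => i _; rewrite !coef_poly.
rewrite (leq_trans _ nN) ?ltn_ord // tp //.
by rewrite (leq_ltn_trans (leq_subr _ _) nN).
Qed.

Lemma fps_mul_trunc (N n : nat) s t : (n < N)%N ->
  fps_mul s t n = (\poly_(i < N) s i * \poly_(i < N) t i)`_n.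
Proof. by move=> nN; apply: fps_mul_truncr => // i iN; rewrite coef_poly iN. Qed.

Let mulC : commutative (@fps_mul R).
Proof.
by move=> s t; apply/funext => n; rewrite !(fps_mul_trunc _ _ (ltnSn n)) mulrC.
Qed.

Let mulA : associative (@fps_mul R).
Proof.
move=> s t u; apply/funext => n.
have mul3 s' t' u' : fps_mul s' (fps_mul t' u') n =
    (\poly_(i < n.+1) s' i * (\poly_(i < n.+1) t' i * \poly_(i < n.+1) u' i))`_n.
  by apply: fps_mul_truncr => // i iN; apply: fps_mul_trunc.
by rewrite (mulC (fps_mul s t)) !mul3 mulrA mulrC.
Qed.

Let mul1 : left_id fps1 (@fps_mul R).
Proof.
move=> s; apply/funext => n; rewrite /fps_mul big_ord_recl mul1r subn0.
by rewrite big1 ?addr0 // => i _; rewrite mul0r.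
Qed.

Let mulDl : left_distributive (@fps_mul R) +%R.
Proof.
move=> s t u; apply/funext => n; rewrite [RHS]/GRing.add/= /fps_mul -big_split /=.
by apply: eq_bigr => i _; rewrite -mulrDl.
Qed.

Let one_neq0 : fps1 != 0.
Proof.
by apply/eqP => /(congr1 (fun s : fps R => s 0%N)) /eqP; rewrite (negPf (oner_neq0 _)).
Qed.

HB.instance Definition _ :=
  GRing.Zmodule_isComNzRing.Build (fps R) mulA mulC mul1 mulDl one_neq0.

Lemma coef_fpsD s t n : (s + t) n = s n + t n. Proof. by []. Qed.

Lemma coef_fpsN s n : (- s) n = - s n. Proof. by []. Qed.

Lemma coef_fpsM s t n : (s * t) n = \sum_(i < n.+1) s i * t (n - i)%N.
Proof. by []. Qed.

Lemma coef_fps1 n : (1 : fps R) n = (n == 0%N)%:R. Proof. by []. Qed.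

Lemma coef_fpsMn s m n : (s *+ m) n = s n *+ m.
Proof. by elim: m => [//|m IH]; rewrite !mulrS coef_fpsD IH. Qed.

Lemma coef_fps_natM (m : nat) s n : (m%:R * s) n = m%:R * s n.
Proof. by rewrite !mulr_natl coef_fpsMn. Qed.

End FpsRing.

Local Notation "p %:S" := (fps_poly p%R) : ring_scope.

Section FpsPoly.
Variable R : comNzRingType.

Let fps_poly_zmod_morphism : zmod_morphism (@fps_poly R).
Proof. by move=> p q; apply/funext => n; apply: coefB. Qed.

Let fps_poly_monoid_morphism : monoid_morphism (@fps_poly R).
Proof.
split; first by apply/funext => n; apply: coef1.
by move=> p q; apply/funext => n; apply: coefM.
Qed.

HB.instance Definition _ :=
  GRing.isZmodMorphism.Build {poly R} (fps R) (@fps_poly R) fps_poly_zmod_morphism.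
HB.instance Definition _ :=
  GRing.isMonoidMorphism.Build {poly R} (fps R) (@fps_poly R) fps_poly_monoid_morphism.

Lemma coef_fpsXM (s : fps R) n : ('X%:S * s) n = if n is n'.+1 then s n' else 0.
Proof.
rewrite coef_fpsM; case: n => [|n]; first by rewrite big_ord1 /fps_poly coefX mul0r.
rewrite 2!big_ord_recl /fps_poly !coefX mul0r mul1r add0r subn1 big1 ?addr0 // => i _.
by rewrite coefX mul0r.
Qed.

Lemma fps_polyZM c p (s : fps R) : (c *: p)%:S * s = c%:P%:S * (p%:S * s).
Proof. by rewrite -mul_polyC rmorphM mulrA. Qed.

End FpsPoly.

Section QuadraticRoot.
Variable R : comNzRingType.
Implicit Types s t : fps R.

Lemma fps_fixpoint (f : fps R -> fps R) :
  (forall n s t, (forall i, (i < n)%N -> s i = t i) -> f s n = f t n) ->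
  exists s, f s = s.
Proof.
move=> f_local; pose a n := iter n f 0.
have stable i n m : (i < n)%N -> (i < m)%N -> a n i = a m i.
  elim/ltn_ind: i n m => i IH [|n] [|m] // ni mi; apply: f_local => j ji.
  by apply: IH => //; apply: leq_trans ji _.
exists (fun n => a n.+1 n); apply/funext => n; apply: (f_local n) => i ni.
exact: stable.
Qed.

Lemma fps_quadratic_root a b c : exists s, a + 'X%:S * (b * s + c * s ^+ 2) = s :> fps R.
Proof.
apply: fps_fixpoint => -[|n] s t st; rewrite !coef_fpsD !coef_fpsXM //; congr (_ + _).
have coef_eq i : (i <= n)%N -> s i = t i by apply: st.
rewrite !coef_fpsD !coef_fpsM; congr (_ + _); apply: eq_bigr => i _.
  by rewrite coef_eq ?leq_subr.
congr (_ * _); rewrite !expr2 !coef_fpsM; apply: eq_bigr => j _.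
have ji : (j <= n - i)%N by rewrite -ltnS.
by rewrite !coef_eq // (leq_trans _ (leq_subr i n)) ?leq_subr.
Qed.

Lemma fps_inv_exists t : exists s, (1 + 'X%:S * t) * s = 1.
Proof.
have [s sE] := fps_quadratic_root 1 (- t) 0; exists s.
by transitivity (s + ('X%:S * t) * s); [|rewrite -{1}sE]; ring.
Qed.

Lemma fps_lreg t : GRing.lreg (1 + 'X%:S * t).
Proof.
have [s sE] := fps_inv_exists t.
by apply: (can_inj (g := *%R s)) => x; rewrite mulrA (mulrC s) sE mul1r.
Qed.

End QuadraticRoot.

Section Euler.
Variable R : comNzRingType.
Implicit Types s t : fps R.

Definition fps_euler s : fps R := fun n => s n *+ n.
(* Otherwise [fps_scope], which is bound to [fps], would read [+] and [*] in the
   argument as [fps_add] and [fps_mul]. *)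
#[global] Arguments fps_euler s%_R.

Let fps_euler_zmod_morphism : zmod_morphism fps_euler.
Proof. by move=> s t; apply/funext => n; rewrite /fps_euler mulrnBl. Qed.

HB.instance Definition _ :=
  GRing.isZmodMorphism.Build (fps R) (fps R) fps_euler fps_euler_zmod_morphism.

Lemma fps_eulerM s t : fps_euler (s * t) = fps_euler s * t + s * fps_euler t.
Proof.
apply/funext => n; rewrite coef_fpsD [LHS]/fps_euler !coef_fpsM -sumrMnl.
rewrite -big_split /=; apply: eq_bigr => i _.
by rewrite mulrnAl mulrnAr -mulrnDr subnKC // -ltnS.
Qed.

Lemma fps_eulerX : fps_euler 'X%:S = 'X%:S.
Proof.
apply/funext => n; rewrite /fps_euler /fps_poly coefX.
by case: n => [|[|n]]; rewrite ?mul0rn ?mulr1n.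
Qed.

Lemma fps_eulerB s t : fps_euler (s - t) = fps_euler s - fps_euler t.
Proof. exact: raddfB. Qed.

Lemma fps_euler_natM m s : fps_euler (m%:R * s) = m%:R * fps_euler s.
Proof. by rewrite !mulr_natl raddfMn. Qed.

Lemma fps_eulerXn n : fps_euler ('X%:S ^+ n) = n%:R * 'X%:S ^+ n :> fps R.
Proof.
elim: n => [|n IH]; last by rewrite exprS fps_eulerM fps_eulerX IH -[n.+1]addn1 natrD; ring.
by apply/funext => -[|n]; rewrite expr0 mul0r /fps_euler ?mulr0n // coef_fps1 mul0rn.
Qed.

Lemma fps_derivXM s : 'X%:S * fps_deriv s = fps_euler s.
Proof. by apply/funext => -[|n]; rewrite coef_fpsXM. Qed.

Lemma fps_derivXnM n s (t := iter n (@fps_deriv R) s) :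
  'X%:S ^+ n.+1 * fps_deriv t = fps_euler ('X%:S ^+ n * t) - n%:R * ('X%:S ^+ n * t).
Proof. by rewrite fps_eulerM fps_eulerXn -fps_derivXM exprS; ring. Qed.

End Euler.

(** * The kernel *)

Section Derivation.
Variables (R : comNzRingType) (T : {additive R -> R}).
Hypothesis TM : forall x y, T (x * y) = T x * y + x * T y.

Lemma derivation1 : T 1 = 0.
Proof.
have : T 1 + 0 = T 1 + T 1 by rewrite addr0 -{1}(mulr1 1) TM mulr1 mul1r.
by move/addrI.
Qed.

Lemma derivation_nat n : T n%:R = 0.
Proof. by rewrite raddfMn derivation1 mul0rn. Qed.

Lemma derivation_exp x n : x * T (x ^+ n) = n%:R * x ^+ n * T x.
Proof.
elim: n => [|n IH]; first by rewrite derivation1 mulr0 !mul0r.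
by rewrite !exprS TM mulrDr [x * (x * _)]mulrCA IH -[n.+1]addn1 natrD; ring.
Qed.

End Derivation.

(* With [x = -1] and [y = 1], the term of index [m + 1] for [a = 3 p] and [b = q]
   is the coefficient of [v^m] in [(1 - q v) / (1 - 3 p v - q v^2)]. *)
Fixpoint linear_recurrence (R : comNzRingType) (a b x y : R) (m : nat) : R :=
  if m is m'.+1 then linear_recurrence a b y (a * y + b * x) m' else x.

(* [z = e / (1 + 3 e)^2], [q = p / (1 + p)] and [A = (1 + 3 e) / (1 + 2 p)].  The
   third equation is solved for [p * q] so that [ring] can rewrite with it. *)
Record kernel_parametrization (R : comNzRingType) (z e p q A : R) : Prop := {
  kernel_e : z * (1 + 3 * e) ^+ 2 = e;
  kernel_p : e = p * (1 + p);
  kernel_q : p * q = p - q;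
  kernel_A : (1 + 2 * p) * A = 1 + 3 * e;
  kernel_add3e_lreg : GRing.lreg (1 + 3 * e);
  kernel_sub3e_lreg : GRing.lreg (1 - 3 * e);
  kernel_add2p_lreg : GRing.lreg (1 + 2 * p) }.

Section Kernel.
Variables (R : comNzRingType) (z e p q A : R).
Hypothesis param : kernel_parametrization z e p q A.

Let eE := kernel_e param.
Let pE := kernel_p param.
Let qE := kernel_q param.
Let AE := kernel_A param.
Let add3e_lreg := kernel_add3e_lreg param.
Let sub3e_lreg := kernel_sub3e_lreg param.
Let add2p_lreg := kernel_add2p_lreg param.

Lemma kernel_linear_recurrence (x y : R) (m : nat) :
  let c := linear_recurrence (3 * p) q x y in
  c m.+2 = z * (c m + 3 * c m.+1 + 4 * c m.+2 + 3 * c m.+3 + c m.+4).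
Proof.
elim: m x y => [|m IH] x y /=; last exact: IH.
apply: add3e_lreg; apply: add3e_lreg; set s := (X in z * X).
transitivity (e * s); last by rewrite -[in LHS]eE; ring.
by rewrite /s; ring: pE qE.
Qed.

Lemma kernel_initial_value :
  let c := linear_recurrence (3 * p) q (-1) 1 in
  A = 1 + z * A * (c 1 + 2 * c 2 + c 3).
Proof.
move=> c; set s := _ + c 3; apply: add2p_lreg; apply: add3e_lreg.
transitivity ((1 + 3 * e) * (1 + 2 * p) + z * ((1 + 3 * e) * ((1 + 2 * p) * A)) * s).
  by rewrite AE -expr2 eE /s /c /=; ring: pE qE.
ring.
Qed.

Variable T : {additive R -> R}.
Hypothesis TM : forall x y, T (x * y) = T x * y + x * T y.
Hypothesis Tz : T z = z.

Let TE :=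
  (TM, raddfB T, raddfD T, derivation1 TM, derivation_nat TM, mul0r, add0r, sub0r).

Lemma derivation_kernel_e : (1 - 3 * e) * T e = e * (1 + 3 * e).
Proof.
have : T (z * (1 + 3 * e) ^+ 2) = T e by rewrite eE.
rewrite expr2 !TE Tz => TeE.
transitivity ((1 + 3 * e) * T e - 6 * (z * (1 + 3 * e) ^+ 2) * T e).
  by rewrite eE; ring.
by rewrite -{1}TeE; transitivity (z * (1 + 3 * e) ^+ 2 * (1 + 3 * e)); [ring | rewrite eE].
Qed.

Lemma derivation_kernel_A : (1 - 3 * e) * (1 + 4 * e) * T A = e * (1 + 6 * e) * A.
Proof.
have TeE : T e = (1 + 2 * p) * T p by rewrite [in LHS]pE !TE; ring.
have : T ((1 + 2 * p) * A) = T (1 + 3 * e) by rewrite AE.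
rewrite !TE => TAE; have vE : 1 + 4 * e = (1 + 2 * p) ^+ 2 by ring: pE.
have {}TAE : (1 + 4 * e) * T A = (3 * ((1 + 2 * p)) - 2 * A) * T e.
  transitivity ((1 + 2 * p) * (2 * T p * A + (1 + 2 * p) * T A)
      - 2 * A * ((1 + 2 * p) * T p)).
    by rewrite vE; ring.
  by rewrite TAE -TeE; ring.
apply: add3e_lreg.
transitivity ((3 * ((1 + 2 * p) * (1 + 3 * e)) - 2 * A * (1 + 3 * e))
    * ((1 - 3 * e) * T e)).
  by rewrite -mulrA TAE; ring.
have AvE : (1 + 2 * p) * (1 + 3 * e) = (1 + 4 * e) * A by rewrite -AE vE; ring.
by rewrite derivation_kernel_e AvE; ring.
Qed.

(* [N] is a polynomial in [e], and [N'] its derivative. *)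
Lemma derivation_mul_kernel_A (a b : nat) (f N N' : R) :
  (1 - 3 * e) ^+ a * (1 + 4 * e) ^+ b * f = N * A -> T N = N' * T e ->
  (1 - 3 * e) ^+ a.+2 * (1 + 4 * e) ^+ b.+1 * T f =
  e * ((1 - 3 * e) * (1 + 4 * e) * (1 + 3 * e) * N'
       + ((1 - 3 * e) * (1 + 6 * e)
          + (1 + 3 * e) * (3 * a%:R * (1 + 4 * e) - 4 * b%:R * (1 - 3 * e))) * N) * A.
Proof.
set u := 1 - 3 * e; set v := 1 + 4 * e => fE TN.
have Tu : u * T u = - 3 * (e * (1 + 3 * e)) by rewrite /u !TE -derivation_kernel_e; ring.
have Tv : u * T v = 4 * (e * (1 + 3 * e)) by rewrite /u /v !TE -derivation_kernel_e; ring.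
have [Tua Tvb] := (derivation_exp TM u a, derivation_exp TM v b).
have TfE : (T (u ^+ a) * v ^+ b + u ^+ a * T (v ^+ b)) * f + u ^+ a * v ^+ b * T f
    = N' * T e * A + N * T A by rewrite -TN -!TM fE.
transitivity (u * v * (N' * (u * T e) * A) + u * N * (u * v * T A)
    - (v * a%:R * (u * T u) + u * b%:R * (u * T v)) * (u ^+ a * v ^+ b * f)).
  transitivity (u ^+ 2 * v * (N' * T e * A + N * T A)
      - (u * v * (u * T (u ^+ a)) * v ^+ b + u ^+ 2 * u ^+ a * (v * T (v ^+ b))) * f).
    by rewrite -TfE !exprS; ring.
  by rewrite Tua Tvb; ring.
by rewrite derivation_kernel_e derivation_kernel_A fE Tu Tv; ring.
Qed.

Lemma derivation2_kernel_A :
  (1 - 3 * e) ^+ 3 * (1 + 4 * e) ^+ 2 * T (T A) =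
  e * (1 + e * (16 + e * (63 + e * (54 - 108 * e)))) * A.
Proof.
have /(@derivation_mul_kernel_A 1 1) -/(_ (1 + 12 * e)) TTA := derivation_kernel_A.
by rewrite TTA ?TE; ring.
Qed.

Lemma derivation3_kernel_A :
  (1 - 3 * e) ^+ 5 * (1 + 4 * e) ^+ 3 * T (T (T A)) =
  e * (1 + e * (38 + e * (406 + e * (1992 + e * (4329 + e * (2646
    + e * (1944 * e - 1296))))))) * A.
Proof.
have /derivation_mul_kernel_A := derivation2_kernel_A.
move=> /(_ (1 + e * (32 + e * (189 + e * (216 - 540 * e))))) ->; first by ring.
by rewrite !TE; ring.
Qed.

Lemma kernel_A_ode :
  - 28 * T (T (T A)) + 22 * T (T A) + 18 * T A
  + z * (329 * T (T (T A)) + 228 * T (T A) - 17 * T A - 12 * A)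
  + z ^+ 2 * (84 * T (T (T A)) + 270 * T (T A) + 258 * T A + 72 * A) = 0.
Proof.
set lhs := LHS; pose u := 1 - 3 * e; pose v := 1 + 4 * e; pose W := 1 + 3 * e.
pose D := u ^+ 5 * v ^+ 3.
have DTA : D * T A = u ^+ 4 * v ^+ 2 * (u * v * T A) by rewrite /D; ring.
have DTTA : D * T (T A) = u ^+ 2 * v * (u ^+ 3 * v ^+ 2 * T (T A)) by rewrite /D; ring.
have lhs0 : W ^+ 4 * (D * lhs) = 0.
  transitivity (W ^+ 4 * (- 28 * (D * T (T (T A))) + 22 * (D * T (T A)) + 18 * (D * T A))
    + z * W ^+ 2 * W ^+ 2 *
      (329 * (D * T (T (T A))) + 228 * (D * T (T A)) - 17 * (D * T A) - 12 * (D * A))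
    + (z * W ^+ 2) ^+ 2 *
      (84 * (D * T (T (T A))) + 270 * (D * T (T A)) + 258 * (D * T A) + 72 * (D * A))).
    by rewrite /lhs; ring.
  rewrite DTTA DTA eE derivation_kernel_A derivation2_kernel_A derivation3_kernel_A.
  by rewrite /D /u /v /W; ring.
have vE : v = (1 + 2 * p) ^+ 2 by rewrite /v; ring: pE.
have reg : GRing.lreg (W ^+ 4 * D).
  by rewrite /D vE; do ![apply: lregM | apply: lregX].
by apply: reg; rewrite mulr0 -mulrA.
Qed.

End Kernel.

(** * The generating function *)

Section MomentSeries.
Variable R : comNzRingType.

Lemma moment_series_unique (S : nat -> fps R) :
  S 0%N = 1 + 'X%:S * (S 0%N + 2 * S 1%N + S 2%N) ->
  S 1%N = 'X%:S * (2 * S 0%N + 4 * S 1%N + 3 * S 2%N + S 3%N) ->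
  (forall m, S m.+2 = 'X%:S * (S m + 3 * S m.+1 + 4 * S m.+2 + 3 * S m.+3 + S m.+4)) ->
  forall k m, S m k = (moment k m)%:R.
Proof.
move=> S0 S1 SS; elim=> [|k IH] [|[|m]].
- by rewrite S0 coef_fpsD coef_fpsXM moment_empty addr0.
- by rewrite S1 coef_fpsXM moment_empty.
- by rewrite SS coef_fpsXM moment_empty.
- rewrite S0 coef_fpsD coef_fpsXM coef_fps1 add0r.
  by rewrite !coef_fpsD !coef_fps_natM !IH moment0S !(natrM, natrD).
- by rewrite S1 coef_fpsXM !coef_fpsD !coef_fps_natM !IH moment1S !(natrM, natrD).
- by rewrite SS coef_fpsXM !coef_fpsD !coef_fps_natM !IH momentSS !(natrM, natrD).
Qed.

Lemma kernel_parametrization_exists :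
  exists e p q A : fps R, kernel_parametrization 'X%:S e p q A.
Proof.
have [e eE] := fps_quadratic_root ('X%:S : fps R) 6 9.
have {}eE : 'X%:S * (1 + 3 * e) ^+ 2 = e by rewrite -[RHS]eE; ring.
set e' := (1 + 3 * e) ^+ 2 in eE.
have [s] := fps_quadratic_root 1 0 (- e').
rewrite mul0r add0r mulNr mulrN mulrA eE => sE.
have [i iE] := fps_inv_exists (e' * s); have [j jE] := fps_inv_exists (2 * (e' * s)).
rewrite mulrA eE in iE; rewrite mulrCA (mulrA 'X%:S) eE in jE.
exists e, (e * s), (e * s * i), ((1 + 3 * e) * j); split=> //.
- by transitivity (e * (s + e * s ^+ 2)); [rewrite -{1}sE; ring | ring].
- by transitivity (e * s * ((1 + e * s) * i) - e * s * i); [ring | rewrite iE mulr1].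
- by rewrite mulrCA jE mulr1.
- by rewrite -eE mulrCA; apply: fps_lreg.
- by rewrite -eE mulrCA -mulrN; apply: fps_lreg.
- by rewrite -eE -mulrA mulrCA; apply: fps_lreg.
Qed.

Lemma coef_kernel_series (e p q A : fps R) (k m : nat) :
  kernel_parametrization 'X%:S e p q A ->
  (A * linear_recurrence (3 * p) q (-1) 1 m.+1) k = (moment k m)%:R.
Proof.
move=> param; set c := linear_recurrence _ _ _ _.
have rec := kernel_linear_recurrence param (-1) 1.
apply: (moment_series_unique (S := fun m => A * c m.+1)) => [||{}m].
- by transitivity A; [apply: mulr1 | rewrite {1}(kernel_initial_value param) -/c; ring].
- have c01 : c 0%N + 3 * c 1%N = 2 * c 1%N by rewrite /c /=; ring.
  by rewrite [c 2%N in LHS](rec 0%N) -/c c01; ring.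
- by rewrite [c _ in LHS](rec m.+1) -/c; ring.
Qed.

Definition op2_123_series : fps R := fun k => (op2_123 k)%:R.

Lemma op2_123_series_ode (T := @fps_euler R) (A := op2_123_series) :
  - 28 * T (T (T A)) + 22 * T (T A) + 18 * T A
  + 'X%:S * (329 * T (T (T A)) + 228 * T (T A) - 17 * T A - 12 * A)
  + 'X%:S ^+ 2 * (84 * T (T (T A)) + 270 * T (T A) + 258 * T A + 72 * A) = 0.
Proof.
have [e [p [q [B param]]]] := kernel_parametrization_exists.
suff -> : A = B by apply: (kernel_A_ode param); [exact: fps_eulerM | exact: fps_eulerX].
apply/funext => k; rewrite /A /op2_123_series op2_123_words -moment0.
by rewrite -(coef_kernel_series _ _ param) mulr1.
Qed.

End MomentSeries.

Section SquareSubstitution.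
Variable R : comNzRingType.
Implicit Type s : fps R.

Definition fps_compX2 s : fps R := fun n => if odd n then 0 else s n./2.
#[global] Arguments fps_compX2 s%_R.

Lemma coef_fps_compX2 s n : fps_compX2 s n = if odd n then 0 else s n./2.
Proof. by []. Qed.

Let fps_compX2_zmod_morphism : zmod_morphism fps_compX2.
Proof.
move=> s t; apply/funext => n; rewrite coef_fpsD coef_fpsN !coef_fps_compX2.
by case: ifP; rewrite ?subr0.
Qed.

HB.instance Definition _ :=
  GRing.isZmodMorphism.Build (fps R) (fps R) fps_compX2 fps_compX2_zmod_morphism.

Let sum_even (F : nat -> R) m : (forall i, odd i -> F i = 0) ->
  \sum_(i < m.*2.+1) F i = \sum_(j < m.+1) F j.*2.
Proof.
move=> F0; elim: m => [|m IH]; first by rewrite !big_ord1.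
rewrite doubleS !(big_ord_recr m.*2.+1, big_ord_recr m.*2.+2, big_ord_recr m.+1) /= IH.
by rewrite (F0 m.*2.+1) ?addr0 //= odd_double.
Qed.

Let fps_compX2_monoid_morphism : monoid_morphism fps_compX2.
Proof.
split=> [|s t]; apply/funext => n; rewrite coef_fps_compX2.
  by case: n => [|[|n]]; rewrite !coef_fps1 //= if_same.
rewrite !coef_fpsM; case: ifPn => [n_odd|/even_halfK nE].
  rewrite big1 // => i _; rewrite !coef_fps_compX2.
  case: ifPn => [|i_even]; first by rewrite mul0r.
  by rewrite oddB -1?ltnS // n_odd (negPf i_even) mulr0.
rewrite -[in RHS]nE (sum_even (F := fun i => fps_compX2 s i * fps_compX2 t (_ - i)%N)).
  apply: eq_bigr => i _; rewrite -doubleB !coef_fps_compX2 !odd_double !doubleK //.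
by move=> i i_odd; rewrite coef_fps_compX2 i_odd mul0r.
Qed.

HB.instance Definition _ :=
  GRing.isMonoidMorphism.Build (fps R) (fps R) fps_compX2 fps_compX2_monoid_morphism.

Lemma fps_compX2X : fps_compX2 'X%:S = 'X%:S ^+ 2.
Proof.
apply/funext => n; rewrite coef_fps_compX2 expr2 coef_fpsXM.
by case: n => [|[|[|[|n]]]]; rewrite /fps_poly !coefX //= if_same.
Qed.

Lemma fps_euler_compX2 s : fps_euler (fps_compX2 s) = 2 * fps_compX2 (fps_euler s).
Proof.
apply/funext => n; rewrite coef_fps_natM /fps_euler /fps_compX2; case: ifPn => [|n_even].
  by rewrite mul0rn mulr0.
by rewrite mulr_natl -mulrnA muln2 even_halfK.
Qed.

End SquareSubstitution.

Lemma fps_compX2_series_ode (R : comNzRingType) (D := @fps_deriv R)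
    (q := fps_compX2 (op2_123_series R)) :
  (84 *: 'X^7 + 329 *: 'X^5 - 28 *: 'X^3)%:S * D (D (D q))
  + (792 *: 'X^6 + 1443 *: 'X^4 - 40 *: 'X^2)%:S * D (D q)
  + (1656 *: 'X^5 + 717 *: 'X^3 + 88 *: 'X)%:S * D q
  + (576 *: 'X^4 - 96 *: 'X^2)%:S * q = 0.
Proof.
pose x : fps R := 'X%:S.
pose t k := fps_compX2 (iter k (@fps_euler R) (op2_123_series R)).
have euler_t k : fps_euler (t k) = 2 * t k.+1 by apply: fps_euler_compX2.
have q1E : x * D q = 2 * t 1%N by rewrite fps_derivXM (euler_t 0).
have q2E : x ^+ 2 * D (D q) = 4 * t 2%N - 2 * t 1%N.
  by rewrite (fps_derivXnM 1) expr1 q1E fps_euler_natM euler_t; ring.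
have q3E : x ^+ 3 * D (D (D q)) = 8 * t 3%N - 12 * t 2%N + 4 * t 1%N.
  by rewrite (fps_derivXnM 2) q2E fps_eulerB !fps_euler_natM !euler_t; ring.
transitivity ((84 * x ^+ 4 + 329 * x ^+ 2 - 28) * (x ^+ 3 * D (D (D q)))
  + (792 * x ^+ 4 + 1443 * x ^+ 2 - 40) * (x ^+ 2 * D (D q))
  + (1656 * x ^+ 4 + 717 * x ^+ 2 + 88) * (x * D q) + (576 * x ^+ 4 - 96 * x ^+ 2) * q).
  by rewrite -!mul_polyC /x; ring.
transitivity (8 * fps_compX2 (0 : fps R)); last by rewrite rmorph0 mulr0.
by rewrite q1E q2E q3E -(op2_123_series_ode R) /t /x /q; ring: (fps_compX2X R).
Qed.

Theorem theorem3p2 :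
  ( ((21 / 2) *: 'X^7 + (329 / 8) *: 'X^5 - (7 / 2) *: 'X^3)%:S * Q^`(3)
  + (99 *: 'X^6 + (1443 / 8) *: 'X^4 - 5 *: 'X^2)%:S * Q^`(2)
  + (207 *: 'X^5 + (717 / 8) *: 'X^3 + 11 *: 'X)%:S * Q^`(1)
  + (72 *: 'X^4 - 12 *: 'X^2)%:S * Q)%fps =1 fps0.
Proof.
move=> n; pose eighth (s : fps rat) := ((8^-1)%:P%:S * s) n.
have := congr1 eighth (fps_compX2_series_ode rat).
rewrite /eighth !mulrDr -!fps_polyZM mulr0; apply: etrans; rewrite /fps_add.
congr (_ + _ + _ + _); congr (fps_mul (fps_poly _) _ _);
  by apply/polyP => i; rewrite !(coefZ, coefB, coefD); field.
Qed.
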